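(* Let $n,k\ge 1$ be positive integers with $n\ge k$. The $k$-nearest neighbor platoon $\mathcal{P}(n,k)$ is a $k$-vertex connected and a $k$-edge connected graph, i.e. its vertex connectivity and edge connectivity satisfy $\kappa(\mathcal{P}(n,k)) = e(\mathcal{P}(n,k)) = k$.
   Context: For positive integers $n,k\ge 1$ with $n\ge k$, the $k$-nearest neighbor platoon $\mathcal{P}(n,k)$ is the undirected simple graph on vertices $v_1,\dots,v_n$ (vehicles in a line, in this order) in which each vertex is adjacent to its $k$ nearest vertices in front and its $k$ nearest vertices behind (or all of those, when fewer than $k$ exist); that is, $v_i$ and $v_j$ are adjacent iff $1\le |i-j|\le k$. For a graph $\mathcal{G}=(\mathcal{V},\mathcal{E})$ and vertices $v_i,v_j$, a $(j,i)$-cut is a set $\mathcal{S}_{ij}\subset\mathcal{V}$ of vertices (not containing $v_i,v_j$) whose removal leaves no path from $v_j$ to $v_i$; $\kappa_{ij}$ is the smallest size of such a cut. The vertex connectivity $\kappa(\mathcal{G})$ is the minimum of $\kappa_{ij}$ over pairs of distinct non-adjacent vertices (with the usual convention $\kappa(\mathcal{G})=|\mathcal{V}|-1$ for a complete graph); $\mathcal{G}$ is called $\kappa$-vertex connected when its vertex connectivity is $\kappa$. The edge connectivity $e(\mathcal{G})$ is the minimum number of edges whose deletion disconnects $\mathcal{G}$.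
   Formalization: The hypothesis n ≥ k is strengthened to n > k: for n = k the platoon P(k,k) is the complete graph on k vertices, whose vertex connectivity is k − 1 by the stated convention, so the claim fails there. *)

(* Defs.v *)
From mathcomp Require Import all_boot ssrint.

Set Implicit Arguments.
Unset Strict Implicit.
Unset Printing Implicit Defensive.

Record sgraph := SGraph {
  vertex :> finType;
  adj : rel vertex;
  adj_sym : symmetric adj;
  adj_irrefl : irreflexive adj }.

Section Connectivity.

Variable G : sgraph.

Definition complete : bool := [forall u : G, forall v : G, (u != v) ==> adj u v].

Definition connected (r : rel G) : bool :=
  [forall u : G, forall v : G, connect r u v].

Definition delete_vertices (S : {set G}) : rel G :=
  [rel u v | [&& adj u v, u \notin S & v \notin S]].

Definition vertex_cut (j i : G) (S : {set G}) : bool :=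
  [&& j \notin S, i \notin S & ~~ connect (delete_vertices S) j i].

(* The index #|G| of the minimum only matters when j and i have no cut, that
   is, when they are equal or adjacent. *)
Definition local_connectivity (j i : G) : nat :=
  \big[minn/#|G|]_(S : {set G} | vertex_cut j i S) #|S|.

Definition vertex_connectivity : nat :=
  if complete then #|G|.-1
  else \big[minn/#|G|]_(p : G * G | (p.1 != p.2) && ~~ adj p.1 p.2)
         local_connectivity p.1 p.2.

Definition edges : {set {set G}} :=
  [set [set p.1; p.2] | p : G * G & adj p.1 p.2].

Definition delete_edges (F : {set {set G}}) : rel G :=
  [rel u v | adj u v && ([set u; v] \notin F)].

(* The index #|edges| is attained by deleting every edge as soon as G has two
   vertices; on a single vertex, which nothing disconnects, it gives 0. *)
Definition edge_connectivity : nat :=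
  \big[minn/#|edges|]_(F : {set {set G}} |
      (F \subset edges) && ~~ connected (delete_edges F)) #|F|.

End Connectivity.

Section Platoon.

Import IntDist.

Variables n k : nat.

(* The subtraction is that of int, not truncated. *)
Definition platoon_adj : rel 'I_n :=
  fun i j : 'I_n => (1 <= `|i - j| <= k)%N.

Lemma platoon_adj_sym : symmetric platoon_adj.
Proof. by move=> i j; rewrite /platoon_adj distnC. Qed.

Lemma platoon_adj_irrefl : irreflexive platoon_adj.
Proof. by move=> i; rewrite /platoon_adj distnn. Qed.

Definition platoon : sgraph := SGraph platoon_adj_sym platoon_adj_irrefl.

End Platoon.

(* Main.v *)
Require Import Defs.
From mathcomp Require Import all_boot.
From mathcomp Require Import order ssrint zify.

(** When [n = k + 1] the platoon is complete, and its vertex connectivity is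
    [n - 1 = k] by convention.  Apart from that value, both connectivities are
    at most the degree of the first vehicle, which is [k]: removing its [k]
    neighbours, or the [k] edges that leave it, isolates it
    ([local_connectivity_le_degree], [star_disconnects]).

    For the other direction, delete fewer than [k] vertices, and keep two
    vehicles [i < j].  Either they are adjacent, or the [k] vehicles that follow
    [i] all come before [j]; one of them survives, and it is a step from [i]
    towards [j] ([platoon_vertex_robust]).

    Now delete fewer than [k] edges.  Since [k < n], two consecutive vehicles
    lie in a common block of [k + 1] consecutive vehicles, which is a clique.
    Inside it they are joined by [k] edge-disjoint paths, the edge between them
    and the [k - 1] paths of length two, so one of these paths survives
    ([clique_edge_robust]).  Hence consecutive vehicles stay connected, and so
    does the whole line ([platoon_edge_robust]). *)

Set Implicit Arguments.
Unset Strict Implicit.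
Unset Printing Implicit Defensive.

(** * Minima of natural numbers *)

Lemma bigminn_le (I : finType) (P : pred I) (F : I -> nat) idx i0 :
  P i0 -> \big[minn/idx]_(i | P i) F i <= F i0.
Proof.
by rewrite -minEnat -leEnat; apply: Order.TotalTheory.bigmin_le_cond.
Qed.

Lemma bigminn_eq (I : finType) (P : pred I) (F : I -> nat) idx m i0 :
    m <= idx -> (forall i, P i -> m <= F i) -> P i0 -> F i0 <= m ->
  \big[minn/idx]_(i | P i) F i = m.
Proof.
move=> m_idx mF Pi0 Fm; apply/eqP; rewrite eqn_leq.
rewrite (leq_trans (bigminn_le F idx Pi0) Fm) /=.
by elim/big_ind: _ => // x y mx my; rewrite leq_min mx my.
Qed.

(** * Connectivity, degree and cliques *)

Section Degree.

Variable G : sgraph.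
Implicit Types u v w : G.

Definition neighbours u : {set G} := [set w | adj u w].

Lemma connect_isolated (r : rel G) u v :
  (forall w, ~~ r u w) -> connect r u v -> u = v.
Proof.
move=> isol /connectP[[|w p] /= pth ->] //.
by case/andP: pth; rewrite (negPf (isol w)).
Qed.

(** The neighbours of [u] form a cut that separates [u] from any vertex that is
    not adjacent to it. *)
Lemma local_connectivity_le_degree u v :
  u != v -> ~~ adj u v -> local_connectivity u v <= #|neighbours u|.
Proof.
move=> uv nadj; apply: (bigminn_le (fun S : {set G} => #|S|)).
rewrite /vertex_cut !inE adj_irrefl nadj /=.
apply/negP => /connect_isolated uE; case/eqP: uv; apply: uE => w.
by apply/negP => /and3P[uw _]; rewrite inE uw.
Qed.

Definition star u : {set {set G}} := [set [set u; w] | w in neighbours u].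

Lemma star_edges u : star u \subset edges G.
Proof.
apply/subsetP => _ /imsetP[w uw ->]; rewrite inE in uw.
by apply/imsetP; exists (u, w); rewrite ?inE.
Qed.

Lemma star_disconnects u v : u != v -> ~~ connected (delete_edges (star u)).
Proof.
move=> uv; apply/negP => /forallP/(_ u)/forallP/(_ v)/connect_isolated uE.
case/eqP: uv; apply: uE => w; apply/negP => /andP[uw].
by case/negP; apply: imset_f; rewrite inE.
Qed.

Lemma edge_connectivity_eq k u v :
    (forall F : {set {set G}}, #|F| < k -> connected (delete_edges F)) ->
  u != v -> #|neighbours u| <= k -> edge_connectivity G = k.
Proof.
move=> robust uv degu.
have cut_ge (F : {set {set G}}) : ~~ connected (delete_edges F) -> k <= #|F|.
  by apply: contraNleq; apply: robust.
apply: (bigminn_eq (i0 := star u)).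
- (* the default value of the minimum counts all edges, among them the star *)
  apply: leq_trans (subset_leq_card (star_edges u)).
  exact/cut_ge/(star_disconnects uv).
- by move=> F /andP[_]; apply: cut_ge.
- by rewrite star_edges (star_disconnects uv).
- exact: leq_trans (leq_imset_card _ _) degu.
Qed.

(** The edge between [u] and [v] and the paths of length two inside [C] are
    edge-disjoint, and there are [#|C|.-1] of them.  If none survived, then
    every vertex [w] of [C] other than [u] would give a deleted edge: {u, w} if
    that one is deleted, and {w, v} otherwise.  These edges are distinct,
    because [w] is [v] or the endpoint outside {u, v}. *)
Lemma clique_edge_robust (C : {set G}) (F : {set {set G}}) u v :
    {in C &, forall x y, x != y -> adj x y} -> u \in C -> v \in C ->
  #|F| < #|C|.-1 -> connect (delete_edges F) u v.
Proof.
move=> clq uC vC ltFC.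
have [-> | uv] := eqVneq u v; first exact: connect0.
apply: contraTT ltFC => disc; rewrite -leqNgt.
have -> : #|C|.-1 = #|C :\ u| by rewrite (cardsD1 u C) uC.
pose f w := if [set u; w] \in F then [set u; w] else [set w; v].
have f_edge w : w \in C :\ u -> f w \in F.
  rewrite /f in_setD1 => /andP[wu wC]; case: ifPn => // uwF.
  have duw : delete_edges F u w by rewrite /delete_edges /= uwF clq // eq_sym.
  apply: contraNT disc => wvF.
  have [wv | wv] := eqVneq w v; first by rewrite -wv connect1.
  apply: connect_trans (connect1 duw) (connect1 _).
  by rewrite /delete_edges /= wvF clq.
rewrite -(card_in_imset (f := f) (D := C :\ u)); last first.
  move=> w w'; rewrite !in_setD1 => /andP[wu _] /andP[w'u _] eqf.
  have mem x : x \in f x by rewrite /f; case: ifP; rewrite !inE eqxx ?orbT.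
  have sub x y : y \in f x -> [|| y == u, y == v | y == x].
    by rewrite /f; case: ifP; rewrite !inE => _ /orP[] ->; rewrite ?orbT.
  have := sub w' w; rewrite -eqf mem (negPf wu) => /(_ isT) /= /pred2P[wv |] //.
  have := sub w w'; rewrite eqf mem (negPf w'u).
  move=> /(_ isT) /= /pred2P[w'v |] //.
  by rewrite wv w'v.
by apply: subset_leq_card; apply/subsetP => _ /imsetP[w wC ->]; apply: f_edge.
Qed.

End Degree.

(** * The nearest neighbor platoon *)

Section Platoon.

Variables n k : nat.
Hypothesis k_gt0 : 0 < k.
Hypothesis lt_kn : k < n.

Local Notation P := (platoon n k).

Lemma platoon_adjE (i j : 'I_n) : i < j -> platoon_adj k i j = (j <= i + k).
Proof.
by move=> ij; rewrite /platoon_adj IntDist.distnEr ?(ltnW ij) //; lia.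
Qed.

Definition block a m : {set 'I_n} := [set w : 'I_n | a <= w < a + m].

Lemma card_block a m : a + m <= n -> #|block a m| = m.
Proof.
move=> amn.
have lt_n (i : 'I_m) : a + i < n by have := ltn_ord i; lia.
rewrite -[RHS]card_ord -(card_imset (f := fun i => Ordinal (lt_n i))); last first.
  by move=> i j [] /addnI /val_inj.
apply: eq_card => w; rewrite inE; apply/idP/imsetP => [/andP[aw wam] | [i _ ->]].
  have wa : w - a < m by lia.
  by exists (Ordinal wa) => //; apply: val_inj => /=; lia.
by rewrite /= leq_addr ltn_add2l ltn_ord.
Qed.

Lemma block_clique a (i j : 'I_n) :
  i \in block a k.+1 -> j \in block a k.+1 -> i != j -> platoon_adj k i j.
Proof.
rewrite !inE => ia ja; rewrite neq_ltn => /orP[] ij.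
  by rewrite platoon_adjE //; lia.
by rewrite platoon_adj_sym platoon_adjE //; lia.
Qed.

Lemma degree_first (i : 'I_n) : i = 0 :> nat -> #|neighbours (i : P)| = k.
Proof.
move=> i0; rewrite -[RHS](@card_block 1 k) //.
apply: eq_card => w; rewrite !inE /= add1n ltnS.
have [w0 | w_gt0] := posnP w.
  have -> : w = i by apply: val_inj; exact: etrans w0 (esym i0).
  by rewrite platoon_adj_irrefl i0.
by rewrite platoon_adjE ?i0.
Qed.

(** The induction is on the distance between [i] and [j], which each step along
    a surviving vehicle decreases. *)
Lemma platoon_vertex_robust (S : {set P}) (i j : P) :
  #|S| < k -> i \notin S -> j \notin S -> connect (delete_vertices S) i j.
Proof.
move=> ltSk iS jS.
have dsym : symmetric (delete_vertices S).
  move=> x y; rewrite /delete_vertices /= platoon_adj_sym.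
  by rewrite [(x \notin S) && _]andbC.
wlog le_ij : i j iS jS / (i : 'I_n) <= (j : 'I_n).
  move=> th; have [/th -> //| ji] := leqP (i : 'I_n) (j : 'I_n).
  by rewrite (sym_connect_sym dsym); apply: th => //; apply: ltnW.
have [d] := ubnP ((j : 'I_n) - (i : 'I_n)).
elim: d => // d IHd in i iS le_ij *; rewrite ltnS => le_d.
have [-> | ij] := eqVneq i j; first exact: connect0.
have lt_ij : (i : 'I_n) < (j : 'I_n) by rewrite ltn_neqAle ij.
have [near | far] := leqP (j : 'I_n) ((i : 'I_n) + k).
  by apply: connect1; rewrite /delete_vertices /= iS jS platoon_adjE // near.
have jn := ltn_ord (j : 'I_n).
have /subsetPn[w] : ~~ (block (i : 'I_n).+1 k \subset S).
  apply: contraL ltSk => /subset_leq_card; rewrite card_block -?leqNgt //; lia.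
rewrite inE => /andP[iw wik] wS.
have iw_adj : delete_vertices S i w.
  by rewrite /delete_vertices /= iS wS platoon_adjE //; lia.
by apply: connect_trans (connect1 iw_adj) (IHd _ wS _ _); lia.
Qed.

Lemma platoon_edge_robust (F : {set {set P}}) :
  #|F| < k -> connected (delete_edges F).
Proof.
move=> ltFk; apply/forallP => i; apply/forallP => j.
have dsym : symmetric (delete_edges F).
  by move=> x y; rewrite /delete_edges /= platoon_adj_sym setUC.
wlog le_ij : i j / (i : 'I_n) <= (j : 'I_n).
  move=> th; have [/th //| ji] := leqP (i : 'I_n) (j : 'I_n).
  by rewrite (sym_connect_sym dsym); apply: th; apply: ltnW.
have [d] := ubnP ((j : 'I_n) - (i : 'I_n)).
elim: d => // d IHd in i le_ij *; rewrite ltnS => le_d.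
have [-> | ij] := eqVneq i j; first exact: connect0.
have lt_ij : (i : 'I_n) < (j : 'I_n) by rewrite ltn_neqAle ij.
have jn := ltn_ord (j : 'I_n).
have i1n : (i : 'I_n).+1 < n by lia.
pose i1 : P := Ordinal i1n.
apply: (@connect_trans _ _ i1); last by apply: IHd => /=; lia.
(* the block starts at [i], or is the last one if fewer than [k] vehicles
   follow [i] *)
pose a := minn (i : 'I_n) (n - k.+1).
apply: (@clique_edge_robust P (block a k.+1)).
- by move=> x y; apply: block_clique.
- by rewrite inE /a; lia.
- by rewrite inE /a /=; lia.
- by rewrite card_block // /a; lia.
Qed.

Lemma platoon_complete : complete P = (n == k.+1).
Proof.
apply/forallP/eqP => [cmpl | nk u].
  have n_gt0 : 0 < n by lia.
  have n1 : n.-1 < n by lia.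
  have /forallP/(_ (Ordinal n1)) := cmpl (Ordinal n_gt0).
  have ne : (Ordinal n_gt0 : P) != Ordinal n1 by rewrite -val_eqE /=; lia.
  by rewrite ne /= platoon_adjE /=; lia.
apply/forallP => v; apply/implyP; have := ltn_ord (u : 'I_n).
have := ltn_ord (v : 'I_n) => vn un.
by apply: (@block_clique 0); rewrite inE /=; lia.
Qed.

Lemma platoon_vertex_connectivity : vertex_connectivity P = k.
Proof.
rewrite /vertex_connectivity platoon_complete card_ord.
have [-> // | n_neq] := eqVneq n k.+1.
have n_gt0 : 0 < n by lia.
have n1 : n.-1 < n by lia.
pose u : P := Ordinal n_gt0; pose v : P := Ordinal n1.
have uv : u != v by rewrite -val_eqE /=; lia.
have nadj : ~~ adj u v by rewrite /= platoon_adjE /=; lia.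
apply: (bigminn_eq (i0 := (u, v))).
- exact: ltnW.
- move=> [x y] _ /=; rewrite /local_connectivity.
  elim/big_ind: _ => [| a b ka kb | S /and3P[xS yS]].
  + by rewrite card_ord ltnW.
  + by rewrite leq_min ka.
  + by apply: contraNleq => ltSk; apply: platoon_vertex_robust.
- by rewrite /= uv.
- apply: leq_trans (local_connectivity_le_degree uv nadj) _.
  by rewrite degree_first.
Qed.

Lemma platoon_edge_connectivity : edge_connectivity P = k.
Proof.
have n_gt0 : 0 < n by lia.
have n_gt1 : 1 < n by lia.
apply: (@edge_connectivity_eq P k (Ordinal n_gt0) (Ordinal n_gt1)) => //.
  exact: platoon_edge_robust.
by rewrite degree_first.
Qed.

End Platoon.

(* For n = k the platoon is the complete graph on k vertices, whose vertex
   connectivity is k - 1; hence k < n. *)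
Theorem lemma1 (n k : nat) (n_ge1 : 1 <= n) (k_ge1 : 1 <= k) (lt_kn : k < n) :
  vertex_connectivity (platoon n k) = k /\ edge_connectivity (platoon n k) = k.
Proof.
by split; [apply: platoon_vertex_connectivity | apply: platoon_edge_connectivity].
Qed.
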